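(* Let $(e_1,\ldots,e_n)$ be the canonical basis of $\mathbb{R}^n$ and let $\mu=\delta_0+\delta_{e_1}+\cdots+\delta_{e_n}$, which generates the exponential family of Bernoulli distributions $p_0\delta_0+p_1\delta_{e_1}+\cdots+p_n\delta_{e_n}$ (with $p_i>0$, $p_0+\cdots+p_n=1$). Then $\mu$ has a dual measure $\mu^*$, a probability on $\mathbb{R}^n$ whose Laplace transform is $$\int_{\mathbb{R}^n}e^{-s_1x_1-\cdots-s_nx_n}\mu^*(dx)=s_1^{s_1}\cdots s_n^{s_n}(1-s_1-\cdots-s_n)^{1-s_1-\cdots-s_n}$$ on $\{s\in\mathbb{R}^n: s_1>0,\ldots,s_n>0,\ 1-s_1-\cdots-s_n>0\}$. Moreover $\mu^*$ is the convolution of $n+1$ probabilities concentrated on the lines $\mathbb{R}e_1,\ldots,\mathbb{R}e_n$ and $\mathbb{R}(-e_1-\cdots-e_n)$: namely, for $i=1,\ldots,n$, the image of the Landau distribution $\varphi$ by $t\mapsto te_i$, and the image of the probability $e^{1-t}\varphi(dt)$ by $t\mapsto -t(e_1+\cdots+e_n)$.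
   Context: The Landau distribution $\varphi$ is the probability on $\mathbb{R}$ with $\int_{\mathbb{R}}e^{-sx}\varphi(dx)=e^{-s}s^s$ for $s>0$. For a positive measure $\mu$ on $\mathbb{R}^n$ let $B_\mu(s)=\int_{\mathbb{R}^n}e^{-\langle s,x\rangle}\mu(dx)$ (its Laplace transform), let $S(\mu)$ be the interior of $\{s: B_\mu(s)<\infty\}$, and $\ell_\mu=\log B_\mu$. $\mathcal{M}(\mathbb{R}^n)$ is the set of positive measures on $\mathbb{R}^n$ not concentrated on an affine hyperplane and with $S(\mu)\neq\emptyset$. The exponential family generated by $\mu$ is $\{e^{-\langle s,x\rangle-\ell_\mu(s)}\mu(dx): s\in S(\mu)\}$, and $M_{F(\mu)}=-\ell'_\mu(S(\mu))$ is the set of its means ($\ell'_\mu$ is the gradient). A measure $\mu^*\in\mathcal{M}(\mathbb{R}^n)$ is a dual measure of $\mu$ if $M_{F(\mu)}\subset S(\mu^* )$ and $-\ell'_{\mu^*}(-\ell'_\mu(s))=s$ for all $s\in S(\mu)$ (unique up to a positive multiplicative constant). *)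

(* Defs.v *)
From HB Require Import structures.
From mathcomp Require Import all_boot all_order all_algebra.
From mathcomp Require Import all_classical all_reals all_analysis.

Set Implicit Arguments.
Unset Strict Implicit.
Unset Printing Implicit Defensive.

Import Order.TTheory GRing.Theory Num.Theory.
Import numFieldNormedType.Exports.

Local Open Scope classical_set_scope.
Local Open Scope ring_scope.

(* R^n is 'rV[R]_n, with the sigma-algebra generated by the n coordinate maps:
   the product of n copies of the Borel sigma-algebra of R, that is, the Borel
   sigma-algebra of R^n. *)

Definition rV_display : measure_display.
Proof. exact: default_measure_display. Qed.

Section measurable_rV.
Context {R : realType} {n : nat}.

Definition rV_coord (i : 'I_n) (x : 'rV[R]_n) : R := x 0 i.

Let rV_set0 : g_sigma_preimage rV_coord set0.
Proof. exact: sigma_algebra0. Qed.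

Let rV_setC A : g_sigma_preimage rV_coord A -> g_sigma_preimage rV_coord (~` A).
Proof. exact: sigma_algebraC. Qed.

Let rV_bigcup (F : (set 'rV[R]_n)^nat) :
  (forall i, g_sigma_preimage rV_coord (F i)) ->
  g_sigma_preimage rV_coord (\bigcup_i (F i)).
Proof. exact: sigma_algebra_bigcup. Qed.

HB.instance Definition _ := @isMeasurable.Build rV_display
  'rV[R]_n (g_sigma_preimage rV_coord) rV_set0 rV_setC rV_bigcup.

End measurable_rV.

Lemma measurable_rV_coord (R : realType) (n : nat) (i : 'I_n) :
  measurable_fun [set: 'rV[R]_n] (@rV_coord R n i).
Proof.
move=> _ Y mY; rewrite setTI; apply: sub_sigma_algebra => /=.
rewrite -bigcup_seq/=; exists i => /=; first by rewrite mem_index_enum.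
by exists Y => //; rewrite setTI.
Qed.

Lemma measurable_fun_rVP d (T : measurableType d) (R : realType) (n : nat)
    (f : T -> 'rV[R]_n) :
  measurable_fun [set: T] f <->
  forall i, measurable_fun [set: T] (fun x => f x 0 i).
Proof.
split=> [mf i|mf].
  exact: (measurableT_comp (@measurable_rV_coord R n i) mf).
suff H : g_sigma_preimage (@rV_coord R n) `<=`
    image_set_system setT f measurable by move=> _ A /H; rewrite /image_set_system /=.
apply: smallest_sub; first exact/sigma_algebra_image/sigma_algebra_measurable.
rewrite -bigcup_seq; apply: bigcup_sub => i _ A [B mB <-].
by rewrite /image_set_system /= setTI; exact: (mf i).
Qed.

Section euclidean.
Context {R : realType} {n : nat}.
Implicit Types (s x : 'rV[R]_n) (f : 'rV[R]_n -> R).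

(* For i < n this is the vector of the canonical basis with index i (from 0). *)
Definition basis_vec (i : nat) : 'rV[R]_n := \row_j (j == i :> nat)%:R.

Definition dot s x : R := \sum_i s 0 i * x 0 i.

Definition gradient f s : 'rV[R]_n := \row_i 'D_(basis_vec i) f s.

Definition hyperplane (a : 'rV[R]_n) (b : R) : set 'rV[R]_n :=
  [set x | dot a x = b].

Definition line (v : 'rV[R]_n) : set 'rV[R]_n := [set t *: v | t in [set: R]].

End euclidean.

Definition concentrated_on d (T : measurableType d) (R : realType)
  (mu : {measure set T -> \bar R}) (A : set T) : Prop := mu (~` A) = 0%E.

Section exponential_families.
Context {R : realType} {n : nat}.
Implicit Types (mu nu : {measure set 'rV[R]_n -> \bar R}) (s : 'rV[R]_n).

Definition laplace mu s : \bar R := (\int[mu]_x (expR (- dot s x))%:E)%E.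

Definition laplace_domain mu : set 'rV[R]_n :=
  interior [set s | (laplace mu s < +oo)%E].

(* Meaningful only on laplace_domain mu, where the Laplace transform is finite
   (and positive as soon as mu is nonzero). This set is open and log_laplace mu
   is smooth on it, so its gradient there is the vector of its partial
   derivatives. *)
Definition log_laplace mu s : R := ln (fine (laplace mu s)).

(* Membership in the class M(R^n). *)
Definition admissible mu : Prop :=
  (forall (a : 'rV[R]_n) (b : R), a != 0 ->
     ~ concentrated_on mu (hyperplane a b)) /\
  laplace_domain mu !=set0.

(* Measures are identified when they agree on measurable sets, since their
   values on other sets are irrelevant. *)
Definition exponential_family mu : set (probability 'rV[R]_n R) :=
  [set P | exists2 s, laplace_domain mu s & forall A, measurable A ->
     P A = (\int[mu]_(x in A) (expR (- dot s x - log_laplace mu s))%:E)%E].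

Definition means_domain mu : set 'rV[R]_n :=
  [set - gradient (log_laplace mu) s | s in laplace_domain mu].

Definition is_dual_measure mu nu : Prop :=
  [/\ admissible nu,
      means_domain mu `<=` laplace_domain nu &
      forall s, laplace_domain mu s ->
        - gradient (log_laplace nu) (- gradient (log_laplace mu) s) = s].

End exponential_families.

Definition is_landau (R : realType) (phi : probability R R) : Prop :=
  forall s : R, 0 < s ->
    (\int[phi]_x (expR (- (s * x)))%:E = (expR (- s) * s `^ s)%:E)%E.

Section bernoulli.
Context {R : realType} {n : nat}.

Definition simplex_measure : {measure set 'rV[R]_n -> \bar R} :=
  measure_add (dirac (0 : 'rV[R]_n)) (msum (fun i => dirac (basis_vec i)) n).

Definition bernoulli_family : set (probability 'rV[R]_n R) :=
  [set P | exists (p0 : R) (p : 'I_n -> R),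
     [/\ 0 < p0, (forall i, 0 < p i), p0 + \sum_i p i = 1 &
      forall A, measurable A ->
        P A = (p0%:E * \d_(0%R : 'rV[R]_n) A +
               \sum_(i < n) (p i)%:E * \d_(basis_vec i : 'rV[R]_n) A)%E]].

End bernoulli.

Section convolution.
Context {R : realType} {n : nat}.

Definition add_pair (xy : 'rV[R]_n * 'rV[R]_n) : 'rV[R]_n := xy.1 + xy.2.

Let measurable_add_pair : measurable_fun setT add_pair.
Proof.
apply/measurable_fun_rVP => i.
rewrite (_ : (fun _ => _) =
    (fun xy : 'rV[R]_n * 'rV[R]_n => rV_coord i xy.1 + rV_coord i xy.2)).
  apply: measurable_realfun.measurable_funD; apply: measurableT_comp => //;
     exact: measurable_rV_coord.
by apply/funext => xy; rewrite /add_pair mxE.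
Qed.

HB.instance Definition _ :=
  isMeasurableFun.Build _ _ _ _ add_pair measurable_add_pair.

Definition convolution (P Q : probability 'rV[R]_n R) : probability 'rV[R]_n R :=
  distribution (P \x Q)%E add_pair.

(* The law dirac 0 is the unit of convolution; it serves as the empty product. *)
Definition convolution_family m (P : 'I_m -> probability 'rV[R]_n R) :
    probability 'rV[R]_n R :=
  \big[convolution/(dirac (0 : 'rV[R]_n) : probability 'rV[R]_n R)]_(i < m) P i.

Definition along (v : 'rV[R]_n) (t : R) : 'rV[R]_n := t *: v.

Let measurable_along v : measurable_fun setT (along v).
Proof.
apply/measurable_fun_rVP => i.
rewrite (_ : (fun _ => _) = (fun t : R => t * v 0 i)).
  exact: measurable_realfun.measurable_funM.
by apply/funext => t; rewrite /along mxE.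
Qed.

HB.instance Definition _ v :=
  isMeasurableFun.Build _ _ _ _ (along v) (measurable_along v).

Definition image_along (v : 'rV[R]_n) (P : probability R R) :
  probability 'rV[R]_n R := distribution P (along v).

End convolution.

(* Main.v *)
Require Import Defs.
From HB Require Import structures.
From mathcomp Require Import all_boot all_order all_algebra.
From mathcomp Require Import all_classical all_reals all_analysis.
From mathcomp Require Import measurable_realfun ring lra.

Set Implicit Arguments.
Unset Strict Implicit.
Unset Printing Implicit Defensive.

Import Order.TTheory GRing.Theory Num.Theory.
Import numFieldNormedType.Exports.

Local Open Scope classical_set_scope.
Local Open Scope ring_scope.

(** For the atoms $0, e_1, ..., e_n$ everything about [simplex_measure] is a
    finite sum: its Laplace transform is $Z(s) = 1 + \sum_i e^{-s_i}$, finite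
    everywhere, and the mean at $s$ has coordinates $e^{-s_i} / Z(s)$, which
    together with the complement $1 / Z(s)$ form a point of the open simplex.
    Inverting, $s_i = - \ln (m_i / (1 - \sum_j m_j))$, so the log-Laplace
    transform of a dual measure has partial derivatives
    $\ln m_i - \ln (1 - \sum_j m_j)$ on the open simplex. The negative entropy
    $\sum_i m_i \ln m_i + (1 - \sum_j m_j) \ln (1 - \sum_j m_j)$ is such a
    function ([gradient_negentropy]).

    It remains to realise the exponential of the negative entropy as the Laplace
    transform of a probability. By Tonelli a Laplace transform turns convolution
    into product ([laplace_convolution]), so the factors may be treated one at a
    time. The image of the Landau law on the line of $e_i$ contributes
    $e^{-s_i} s_i^{s_i}$. The Landau law reweighted by $e^{1-t}$ has mass $1$
    because the transform of the Landau law at $1$ is $e^{-1}$; its image by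
    $t \mapsto - t (e_1 + ... + e_n)$ contributes
    $e^{\sigma} (1 - \sigma)^{1 - \sigma}$ with $\sigma = \sum_i s_i$
    ([laplace_tilted_landau]). The exponential factors $e^{-s_i}$ and
    $e^{\sigma}$ cancel.

    Finally the dual measure charges the complement of every hyperplane: on a
    measure carried by $\{x : \langle a, x \rangle = b\}$ the log-Laplace
    transform is affine in the direction $a$ ([laplace_concentrated]), whereas
    the negative entropy has a strict minimum at the barycenter of the simplex
    ([negentropy_gt_barycenter]). *)

(** * The pairing on row vectors *)

Lemma measurable_dot (R : realType) (n : nat) (s : 'rV[R]_n) :
  measurable_fun [set: 'rV[R]_n] (dot s).
Proof.
apply: measurable_sum => i; apply: measurable_funM => //.
exact: measurable_rV_coord.
Qed.

Lemma measurable_exp_dot (R : realType) (n : nat) (s : 'rV[R]_n) (c : R)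
    (A : set 'rV[R]_n) :
  measurable_fun A (fun x => (expR (- dot s x - c))%:E).
Proof.
apply: measurable_funTS; apply/measurable_EFinP; apply: measurableT_comp => //.
apply: measurable_funB => //; apply: measurableT_comp => //.
exact: measurable_dot.
Qed.

Lemma measurable_exp_dot0 (R : realType) (n : nat) (s : 'rV[R]_n)
    (A : set 'rV[R]_n) :
  measurable_fun A (fun x => (expR (- dot s x))%:E).
Proof. by have := @measurable_exp_dot R n s 0 A; under eq_fun do rewrite subr0. Qed.

Lemma dot_basis (R : realType) (n : nat) (s : 'rV[R]_n) (i : 'I_n) :
  dot s (basis_vec i) = s 0 i.
Proof.
rewrite /dot (bigD1 i)//= mxE eqxx mulr1 big1 ?addr0// => j ji.
by rewrite mxE (inj_eq val_inj) (negbTE ji) mulr0.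
Qed.

Lemma dot0 (R : realType) (n : nat) (s : 'rV[R]_n) : dot s 0 = 0.
Proof. by rewrite /dot big1// => i _; rewrite mxE mulr0. Qed.

Lemma dotDr (R : realType) (n : nat) (s x y : 'rV[R]_n) :
  dot s (x + y) = dot s x + dot s y.
Proof. by rewrite /dot -big_split/=; apply: eq_bigr => i _; rewrite mxE mulrDr. Qed.

Lemma dotZr (R : realType) (n : nat) (s x : 'rV[R]_n) (t : R) :
  dot s (t *: x) = t * dot s x.
Proof. by rewrite /dot mulr_sumr; apply: eq_bigr => i _; rewrite mxE mulrCA. Qed.

Lemma dotC (R : realType) (n : nat) (s x : 'rV[R]_n) : dot s x = dot x s.
Proof. by apply: eq_bigr => i _; rewrite mulrC. Qed.

(** * The measure on the vertices of the simplex *)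

Lemma integral_simplex_measure (R : realType) (n : nat) (A : set 'rV[R]_n)
    (f : 'rV[R]_n -> \bar R) : measurable A -> measurable_fun A f ->
    (forall x, 0 <= f x)%E ->
  (\int[simplex_measure]_(x in A) f x =
   \d_(0%R : 'rV[R]_n) A * f 0%R +
   \sum_(i < n) \d_(basis_vec i : 'rV[R]_n) A * f (basis_vec i))%E.
Proof.
move=> mA mf f0; rewrite ge0_integral_measure_add// integral_dirac//.
congr (_ + _)%E; rewrite ge0_integral_measure_sum//.
by apply: eq_bigr => i _; rewrite integral_dirac.
Qed.

Lemma integral_exp_simplex_measure (R : realType) (n : nat) (A : set 'rV[R]_n)
    (s : 'rV[R]_n) (c : R) : measurable A ->
  (\int[simplex_measure]_(x in A) (expR (- dot s x - c))%:E =
   (expR (- c))%:E * \d_(0%R : 'rV[R]_n) A +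
   \sum_(i < n) (expR (- s ord0 i - c))%:E * \d_(basis_vec i : 'rV[R]_n) A)%E.
Proof.
move=> mA; rewrite integral_simplex_measure//; last first.
- exact: measurable_exp_dot.
rewrite dot0 oppr0 add0r muleC; congr (_ + _)%E.
by apply: eq_bigr => i _; rewrite dot_basis muleC.
Qed.

(** The partition function: this is the Laplace transform of [simplex_measure]. *)
Definition bernoulli_partition (R : realType) (n : nat) (s : 'rV[R]_n) : R :=
  1 + \sum_i expR (- s 0 i).

Lemma bernoulli_partition_gt0 (R : realType) (n : nat) (s : 'rV[R]_n) :
  0 < bernoulli_partition s.
Proof. by rewrite ltr_wpDr// sumr_ge0// => i _; exact: expR_ge0. Qed.

Lemma laplace_simplex_measure (R : realType) (n : nat) (s : 'rV[R]_n) :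
  laplace simplex_measure s = (bernoulli_partition s)%:E.
Proof.
rewrite /laplace; under eq_integral do rewrite -[- dot _ _]subr0.
rewrite integral_exp_simplex_measure// oppr0 expR0 diracT mule1.
rewrite /bernoulli_partition EFinD -sumEFin; congr (_ + _)%E.
by apply: eq_bigr => i _; rewrite addr0 diracT mule1.
Qed.

Lemma log_laplace_simplex_measure (R : realType) (n : nat) (s : 'rV[R]_n) :
  log_laplace simplex_measure s = ln (bernoulli_partition s).
Proof. by rewrite /log_laplace laplace_simplex_measure. Qed.

Lemma laplace_domain_simplex_measure (R : realType) (n : nat) :
  laplace_domain (simplex_measure : {measure set 'rV[R]_n -> \bar R}) = setT.
Proof.
rewrite /laplace_domain (_ : [set s | _] = setT) ?interiorT//.
by apply/seteqP; split=> // s _ /=; rewrite laplace_simplex_measure ltry.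
Qed.

(** A hyperplane $\langle a, x \rangle = b$ of full mass contains the atom $0$,
    so $b = 0$, and each atom $e_i$, so $a_i = b = 0$. *)
Lemma admissible_simplex_measure (R : realType) (n : nat) :
  admissible (simplex_measure : {measure set 'rV[R]_n -> \bar R}).
Proof.
split; last by rewrite laplace_domain_simplex_measure; exists 0.
move=> a b + H; move/negP; apply; apply/eqP/rowP => i; rewrite mxE.
have on_plane x : dirac x (~` hyperplane a b) = 0%E :> \bar R -> dot a x = b.
  rewrite diracE; case: (boolP (x \in _)) => [_ /eqP|]; first by rewrite onee_eq0.
  by rewrite notin_setE /= => /contrapT.
pose H' := ~` hyperplane a b.
have : (\d_(0%R : 'rV[R]_n) H' + \sum_(i < n) \d_(basis_vec i : 'rV[R]_n) H' = 0 :> \bar R)%E.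
  by apply: etrans H; rewrite [RHS]measure_addE.
move/eqP; rewrite padde_eq0 ?sume_ge0// => /andP[/eqP H0 /eqP H1].
have <- : dot a (basis_vec i) = a ord0 i by rewrite dot_basis.
have -> : dot a (basis_vec i) = b.
  apply: on_plane; move: H1 => /eqP.
  by rewrite (bigD1 i)//= padde_eq0 ?sume_ge0// => /andP[/eqP].
by rewrite -(on_plane _ H0) dot0.
Qed.

(** The member of parameter $s$ has weights $1 / Z(s)$ at $0$ and
    $e^{-s_i} / Z(s)$ at $e_i$; conversely, weights $p_0, p_i$ come from
    $s_i = \ln p_0 - \ln p_i$. *)
Lemma exponential_family_simplex_measure (R : realType) (n : nat) :
  exponential_family (simplex_measure : {measure set 'rV[R]_n -> \bar R}) =
  bernoulli_family.
Proof.
apply/seteqP; split=> [P [s _ Ps]|P [p0 [p [p0_gt0 p_gt0 sum_p Pp]]]].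
  set c := log_laplace _ s in Ps.
  have cE : expR (- c) = (bernoulli_partition s)^-1.
    by rewrite expRN /c log_laplace_simplex_measure lnK// posrE bernoulli_partition_gt0.
  exists (expR (- c)), (fun i => expR (- s 0 i - c)); split.
  - exact: expR_gt0.
  - by move=> i; exact: expR_gt0.
  - under eq_bigr do rewrite expRD.
    rewrite -mulr_suml -{1}[expR _]mul1r -mulrDl cE divff// gt_eqF//.
    exact: bernoulli_partition_gt0.
  - by move=> A mA; rewrite Ps// integral_exp_simplex_measure.
pose s : 'rV[R]_n := \row_i (ln p0 - ln (p i)).
have sE i : expR (- s 0 i) = p i / p0.
  by rewrite mxE opprB expRB !lnK// posrE.
exists s; first by rewrite laplace_domain_simplex_measure.
have cE : log_laplace simplex_measure s = - ln p0.
  rewrite log_laplace_simplex_measure /bernoulli_partition.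
  under eq_bigr do rewrite sE.
  rewrite -mulr_suml -[X in X + _](divff (lt0r_neq0 p0_gt0)) -mulrDl sum_p.
  by rewrite mul1r lnV.
move=> A mA; rewrite Pp// cE integral_exp_simplex_measure// opprK lnK//.
congr (_ + _)%E; apply: eq_bigr => i _; congr (_%:E * _)%E.
by rewrite expRD sE lnK// divfK// gt_eqF.
Qed.

(** * Laplace transforms of convolutions and images *)

Lemma laplace_convolution (R : realType) (n : nat)
    (P Q : probability 'rV[R]_n R) (s : 'rV[R]_n) :
  laplace (convolution P Q) s = (laplace P s * laplace Q s)%E.
Proof.
rewrite /laplace ge0_integral_distribution//; last first.
- exact: measurable_exp_dot0.
have mexp : measurable_fun [set: 'rV[R]_n] (fun x => (expR (- dot s x))%:E).
  exact: measurable_exp_dot0.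
rewrite fubini_tonelli1//=; last first.
- exact: (measurableT_comp mexp).
rewrite /fubini_F /=.
under eq_integral => x _.
  rewrite (_ : (\int[Q]_y _ =
      (expR (- dot s x))%:E * \int[Q]_y (expR (- dot s y))%:E)%E); last first.
    rewrite -ge0_integralZl_EFin ?expR_ge0//.
    by apply: eq_integral => y _; rewrite /add_pair/= dotDr opprD expRD EFinM.
  over.
rewrite /= ge0_integralZr//.
by apply: integral_ge0 => y _; rewrite lee_fin expR_ge0.
Qed.

Lemma laplace_dirac0 (R : realType) (n : nat) (s : 'rV[R]_n) :
  laplace (dirac (0 : 'rV[R]_n) : probability 'rV[R]_n R) s = 1%E.
Proof.
rewrite /laplace integral_dirac//; last first.
  exact: measurable_exp_dot0.
by rewrite diracT mul1e dot0 oppr0 expR0.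
Qed.

Lemma laplace_convolution_family (R : realType) (n m : nat)
    (P : 'I_m -> probability 'rV[R]_n R) (s : 'rV[R]_n) :
  laplace (convolution_family P) s = (\prod_(i < m) laplace (P i) s)%E.
Proof.
exact: (big_morph (fun P : probability 'rV[R]_n R => laplace P s)
  (fun P Q => laplace_convolution P Q s) (laplace_dirac0 s)).
Qed.

Lemma laplace_image_along (R : realType) (n : nat) (v s : 'rV[R]_n)
    (P : probability R R) :
  laplace (image_along v P) s = (\int[P]_t (expR (- (dot s v * t)))%:E)%E.
Proof.
rewrite /laplace ge0_integral_distribution//; last first.
- exact: measurable_exp_dot0.
by apply: eq_integral => t _; rewrite /along /= dotZr mulrC.
Qed.

Lemma concentrated_on_line (R : realType) (n : nat) (v : 'rV[R]_n)
    (P : probability R R) : concentrated_on (image_along v P) (line v).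
Proof.
rewrite /concentrated_on; change (P (along v @^-1` (~` line v)) = 0%E).
rewrite (_ : _ @^-1` _ = set0) ?measure0//.
by apply/seteqP; split=> // t /=; apply; exists t.
Qed.

(** * Probabilities with a density *)

Lemma density_probability d (T : measurableType d) (R : realType)
    (P : probability T R) (g : T -> R) : measurable_fun [set: T] g ->
    (forall x, 0 <= g x) -> (\int[P]_x (g x)%:E = 1)%E ->
  exists Q : probability T R,
    forall A, measurable A -> Q A = (\int[P]_(x in A) (g x)%:E)%E.
Proof.
move=> mg g0 g1; pose m A := (\int[P]_(x in A) (g x)%:E)%E.
have m0 : m set0 = 0%E by exact: integral_set0.
have m_ge0 A : (0 <= m A)%E by apply: integral_ge0 => x _; rewrite lee_fin.
have m_additive : semi_sigma_additive m.
  apply: semi_sigma_additive_nng_induced; first exact/measurable_EFinP.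
  by move=> x; rewrite lee_fin.
pose m_measure := isMeasure.Build d T R m m0 m_ge0 m_additive.
pose M : {measure set T -> \bar R} := HB.pack m m_measure.
pose m_probability := Measure_isProbability.Build d T R M g1.
pose Q : probability T R := HB.pack (Measure.sort M) m_probability.
by exists Q.
Qed.

(** The function $g$ is almost everywhere the Radon-Nikodym derivative of $Q$ with
    respect to $P$, since both integrate to $Q$ over every measurable set; the
    change of variables for that derivative then applies. *)
Lemma ge0_integral_density d (T : measurableType d) (R : realType)
    (P Q : probability T R) (g : T -> R) : measurable_fun [set: T] g ->
    (forall x, 0 <= g x) ->
    (forall A, measurable A -> Q A = (\int[P]_(x in A) (g x)%:E)%E) ->
  forall f : T -> \bar R, measurable_fun [set: T] f -> (forall x, 0 <= f x)%E ->
  (\int[Q]_x f x = \int[P]_x (f x * (g x)%:E))%E.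
Proof.
move=> mg g0 Qg f mf f0.
have mgE : measurable_fun [set: T] (EFin \o g) by exact/measurable_EFinP.
have QP : Q `<< P.
  apply/null_content_dominatesP => A mA PA; rewrite Qg//.
  by rewrite null_set_integral//; exact: measurable_funTS.
rewrite -(Radon_Nikodym_SigmaFinite.change_of_variables QP f0 measurableT mf).
have mrn := measurable_int _ (Radon_Nikodym_SigmaFinite.f_integrable QP).
apply: ge0_ae_eq_integral => //.
- exact: emeasurable_funM.
- exact: emeasurable_funM.
- by move=> x _; rewrite mule_ge0// Radon_Nikodym_SigmaFinite.f_ge0.
- by move=> x _; rewrite mule_ge0// lee_fin.
- apply: ae_eqe_mul2l; apply: integral_ae_eq => //.
    exact: Radon_Nikodym_SigmaFinite.f_integrable.
  move=> A _ mA; apply: etrans (Qg A mA).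
  exact/esym/(Radon_Nikodym_SigmaFinite.f_integral QP).
Qed.

(** * The reweighted Landau law *)

Section tilted_landau.
Variables (R : realType) (phi : probability R R).
Hypothesis landau_phi : is_landau phi.

Let tilt (t : R) := expR (1 - t).

Let measurable_tilt : measurable_fun [set: R] tilt.
Proof. by apply: measurableT_comp => //; exact: measurable_funB. Qed.

(** Up to the factor $e$, the integrand is $e^{-ut}$: this is the defining
    integral of the Landau law. *)
Lemma integral_tilted_landau (u : R) : 0 < u ->
  (\int[phi]_t ((expR ((1 - u) * t))%:E * (tilt t)%:E) =
   (expR (1 - u) * u `^ u)%:E)%E.
Proof.
move=> u0; transitivity (\int[phi]_t ((expR 1)%:E * (expR (- (u * t)))%:E))%E.
  apply: eq_integral => t _; rewrite -!EFinM -!expRD; congr (expR _)%:E.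
  by rewrite mulrBl mul1r addrC addrA subrK.
rewrite ge0_integralZl_EFin ?expR_ge0//; last first.
  apply/measurable_EFinP; apply: measurableT_comp => //.
  by apply: measurableT_comp => //; exact: measurable_funM.
by rewrite landau_phi// -EFinM mulrA -expRD.
Qed.

(** The total mass is the preceding integral at $u = 1$. *)
Lemma tilted_landau_probability : exists psi : probability R R,
  forall A, measurable A -> psi A = (\int[phi]_(t in A) (expR (1 - t))%:E)%E.
Proof.
apply: density_probability => //.
have := integral_tilted_landau ltr01.
rewrite subrr expR0 powR1 mulr1 => <-.
by apply: eq_integral => t _; rewrite mul0r expR0 mul1e.
Qed.

Lemma laplace_tilted_landau (psi : probability R R) (u : R) :
  (forall A, measurable A -> psi A = (\int[phi]_(t in A) (expR (1 - t))%:E)%E) ->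
  0 < u ->
  (\int[psi]_t (expR ((1 - u) * t))%:E = (expR (1 - u) * u `^ u)%:E)%E.
Proof.
move=> psiE u0; rewrite -integral_tilted_landau//.
apply: (ge0_integral_density measurable_tilt) => //.
- by move=> t; exact: expR_ge0.
- apply/measurable_EFinP; apply: measurableT_comp => //; exact: measurable_funM.
Qed.

End tilted_landau.

(** * Measures carried by a hyperplane *)

(** On the hyperplane $\langle h a + s, x \rangle = h b + \langle s, x \rangle$. *)
Lemma laplace_concentrated (R : realType) (n : nat)
    (mu : {measure set 'rV[R]_n -> \bar R}) (a : 'rV[R]_n) (b : R) :
  concentrated_on mu (hyperplane a b) ->
  forall (s : 'rV[R]_n) (h : R),
  laplace mu (h *: a + s) = ((expR (- (h * b)))%:E * laplace mu s)%E.
Proof.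
move=> mu_ab s h.
rewrite /laplace -ge0_integralZl_EFin ?expR_ge0//; last exact: measurable_exp_dot0.
apply: ge0_ae_eq_integral => //.
- exact: measurable_exp_dot0.
- by apply: emeasurable_funM => //; exact: measurable_exp_dot0.
- exists (~` hyperplane a b); split => //.
    apply: measurableC; rewrite -[hyperplane _ _]setTI.
    exact: (measurable_dot a measurableT (measurable_set1 b)).
  apply: subsetC => x xab _; rewrite -EFinM -expRD; congr (expR _)%:E.
  by rewrite dotC dotDr dotZr (dotC x a) (dotC x s) xab opprD.
Qed.

(** * The negative entropy on the open simplex *)

Section open_simplex.
Variables (R : realType) (n : nat).

Definition open_simplex : set 'rV[R]_n :=
  [set s | (forall i, 0 < s 0 i) /\ 0 < 1 - \sum_i s 0 i].

Lemma open_open_simplex : open open_simplex.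
Proof.
rewrite openE => s [s_gt0 s_lt1].
have cs i : (fun t : 'rV[R]_n => t 0 i) t @[t --> s] --> s 0 i.
  exact: coord_continuous.
have csum : (1 - \sum_i t 0 i) @[t --> s] --> 1 - \sum_i s 0 i.
  apply: cvgB; first exact: cvg_cst.
  by apply: cvg_big => [|i _]; [exact: add_continuous|exact: cs].
suff : \forall t \near s, open_simplex t by [].
near=> t; split; near: t; last exact: (cvgr_gt _ csum).
by apply: filter_forall => i; exact: (cvgr_gt _ (cs i)).
Unshelve. all: by end_near. Qed.

Definition negentropy (s : 'rV[R]_n) : R :=
  \sum_i s 0 i * ln (s 0 i) + (1 - \sum_i s 0 i) * ln (1 - \sum_i s 0 i).

Lemma expR_negentropy (s : 'rV[R]_n) : open_simplex s ->
  expR (negentropy s) =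
  (\prod_i (s 0 i) `^ (s 0 i)) * (1 - \sum_i s 0 i) `^ (1 - \sum_i s 0 i).
Proof.
move=> [s_gt0 s_lt1]; rewrite expRD expR_sum /powR gt_eqF//; congr (_ * _).
by apply: eq_bigr => i _; rewrite gt_eqF.
Qed.

(** The point whose $n$ coordinates and complement to $1$ are all equal: the mean
    of the uniform law on the vertices of the simplex. *)
Definition barycenter : 'rV[R]_n := const_mx n.+1%:R^-1.

Lemma barycenter_last : 1 - \sum_i barycenter 0 i = n.+1%:R^-1.
Proof.
under eq_bigr do rewrite mxE.
rewrite sumr_const card_ord -mulr_natl.
by rewrite -natr1; field; rewrite natr1 pnatr_eq0.
Qed.

Lemma open_simplex_barycenter : open_simplex barycenter.
Proof. by split=> [i|]; rewrite ?barycenter_last ?mxE invr_gt0. Qed.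

Lemma negentropy_barycenter : negentropy barycenter = ln n.+1%:R^-1.
Proof.
rewrite /negentropy barycenter_last.
under eq_bigr do rewrite mxE.
rewrite sumr_const card_ord -mulr_natl.
by move: (ln _) => l; rewrite -natr1; field; rewrite natr1 pnatr_eq0.
Qed.

(** Strict convexity of $x \ln x$: it lies above its tangent at $c$. Dividing by
    $x$, this is $1 + y < e^y$ at $y = \ln (c / x)$. *)
Lemma xlnx_gt_tangent (x c : R) : 0 < x -> 0 < c -> x != c ->
  x * ln c + x - c < x * ln x.
Proof.
move=> x0 c0 xc; have : ln (c / x) != 0.
  rewrite ln_eq0 ?divr_gt0//; apply: contra_neq xc => cx1.
  by rewrite -[RHS](divfK (lt0r_neq0 x0)) cx1 mul1r.
move/expR_gt1Dx; rewrite lnK ?posrE ?divr_gt0// ln_div ?posrE//.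
rewrite -(ltr_pM2l x0) [x * (c / x)]mulrC divfK ?gt_eqF// => ?.
lra.
Qed.

Lemma xlnx_ge_tangent (x c : R) : 0 < x -> 0 < c ->
  x * ln c + x - c <= x * ln x.
Proof.
move=> x0 c0; have [->|xc] := eqVneq x c; first by rewrite addrK.
exact/ltW/xlnx_gt_tangent.
Qed.

(** Bound each of the $n + 1$ terms $x \ln x$ below by its tangent at
    $c = 1 / (n + 1)$. As the $n + 1$ arguments sum to $1 = (n + 1) c$, the
    tangents sum to $\ln c$, the value at the barycenter; and one bound is strict
    off the barycenter. *)
Lemma negentropy_gt_barycenter (s : 'rV[R]_n) : open_simplex s ->
  s != barycenter -> negentropy barycenter < negentropy s.
Proof.
move=> [s_gt0 s_lt1] s_neq; rewrite negentropy_barycenter.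
set c : R := n.+1%:R^-1; have c0 : 0 < c by rewrite invr_gt0.
have [i sic] : exists i, s 0 i != c.
  apply/existsP; apply: contraNT s_neq; rewrite negb_exists => /forallP sc.
  by apply/eqP/rowP => i; rewrite mxE; apply/eqP; move: (sc i); rewrite negbK.
pose tangent (x : R) := x * ln c + x - c.
have -> : ln c = \sum_j tangent (s 0 j) + tangent (1 - \sum_j s 0 j).
  rewrite /tangent !big_split/= -mulr_suml sumr_const card_ord.
  have nc : c *+ n + c = 1 by rewrite -mulrSr -mulr_natl divff ?pnatr_eq0.
  rewrite mulNrn; move: (ln c) (\sum_j _) => l t.
  apply/eqP; rewrite -subr_eq0; apply/eqP.
  transitivity (c *+ n + c - 1); last by rewrite nc subrr.
  ring.
apply: ltr_leD; last exact: xlnx_ge_tangent.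
rewrite (bigD1 i)//= [ltRHS](bigD1 i)//=; apply: ltr_leD.
  exact: xlnx_gt_tangent.
by apply: ler_sum => j _; exact: xlnx_ge_tangent.
Qed.

End open_simplex.

(** If the measure were carried by $\langle a, x \rangle = b$, moving from the
    barycenter by $h a$ would change the negative entropy by $- h b$. The change
    is positive for both signs of a small nonzero $h$, which is absurd. *)
Lemma not_concentrated_negentropy (R : realType) (n : nat)
    (nu : {measure set 'rV[R]_n -> \bar R}) :
  (forall s, open_simplex s -> laplace nu s = (expR (negentropy s))%:E) ->
  forall (a : 'rV[R]_n) (b : R), a != 0 -> ~ concentrated_on nu (hyperplane a b).
Proof.
move=> nuE a b a0 nu_ab; set c : 'rV[R]_n := barycenter R n.
(* The negative entropy increases by - h * b, so h * b is negative. *)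
have gap h : h != 0 -> open_simplex (h *: a + c) -> h * b < 0.
  move=> h0 hac.
  have := laplace_concentrated nu_ab c h.
  rewrite !nuE//; last exact: open_simplex_barycenter.
  rewrite -EFinM -expRD => -[/expR_inj E].
  have : negentropy c < negentropy (h *: a + c).
    apply: negentropy_gt_barycenter => //.
    by rewrite -subr_eq0 addrK scaler_eq0 negb_or h0.
  by rewrite E ltrDr oppr_gt0.
have near_c : \forall h \near (0 : R), open_simplex (h *: a + c).
  have : h *: a + c @[h --> (0:R)] --> 0 *: a + c.
    by apply: cvgD; [exact: scalel_continuous|exact: cvg_cst].
  apply; rewrite scale0r add0r; apply: open_nbhs_nbhs; split.
    exact: open_open_simplex.
  exact: open_simplex_barycenter.
have near_cN : \forall h \near (0 : R), open_simplex (- h *: a + c).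
  have : - h @[h --> (0:R)] --> (0:R).
    by rewrite -[X in _ --> X]oppr0; apply: cvgN; exact: cvg_id.
  by move=> /(_ _ near_c).
have [h [h0 [hc hNc]]] : exists h : R, h != 0 /\
    open_simplex (h *: a + c) /\ open_simplex (- h *: a + c).
  have : \forall h \near (0:R)^', h != 0 /\
      open_simplex (h *: a + c) /\ open_simplex (- h *: a + c).
    near=> h; split; first by near: h; exact: (nbhs_dnbhs_neq (0 : R)).
    by split; near: h; [exact: (nbhs_dnbhs near_c)|exact: (nbhs_dnbhs near_cN)].
  by move/filter_ex.
have := gap h h0 hc.
have := gap (- h); rewrite oppr_eq0 => /(_ h0 hNc).
rewrite mulNr oppr_lt0 => ? ?; lra.
Unshelve. all: by end_near. Qed.

(** * Gradients *)

(** Reduces partial derivatives to derivatives of functions of one real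
    variable. *)
Lemma derive_is_derive1 (R : realType) (n : nat) (f : 'rV[R]_n -> R)
    (s v : 'rV[R]_n) (l : R) :
  is_derive (0:R) 1 (fun h : R => f (h *: v + s)) l -> 'D_v f s = l.
Proof.
move=> [_ <-]; rewrite /derive; set g1 := fun h => h^-1 *: _.
set g2 := fun h => h^-1 *: _; suff -> : g1 = g2 by [].
by apply/funext => h; rewrite /g1 /g2 /= addr0 scale0r add0r [_%:A]mulr1.
Qed.

Lemma is_derive_translation (R : realType) (c x : R) :
  is_derive x 1 (fun h => h + c) 1.
Proof.
rewrite -[X in is_derive _ _ _ X]addr0.
exact: (is_deriveD (is_derive_id x 1) (is_derive_cst c x 1)).
Qed.

Lemma sum_shift_basis (R : realType) (n : nat) (F : R -> R)
    (s : 'rV[R]_n) (i : 'I_n) (h : R) :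
  \sum_j F ((h *: basis_vec i + s) 0 j) =
  F (h + s 0 i) + \sum_(j | j != i) F (s 0 j).
Proof.
rewrite (bigD1 i)//= !mxE eqxx mulr1; congr (_ + _).
by apply: eq_bigr => j ji; rewrite !mxE (inj_eq val_inj) (negbTE ji) mulr0 add0r.
Qed.

(** Along $e_i$ only one term of the partition function moves: it is a constant
    plus an exponential. *)
Lemma gradient_log_laplace_simplex_measure (R : realType) (n : nat)
    (s : 'rV[R]_n) :
  gradient (log_laplace simplex_measure) s =
  - \row_i (expR (- s 0 i) / bernoulli_partition s).
Proof.
apply/rowP => i; rewrite !mxE; apply: derive_is_derive1.
pose K := 1 + \sum_(j | j != i) expR (- s 0 j).
rewrite (_ : (fun h => _) = (fun h => ln (K + expR (- (h + s 0 i))))); last first.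
  apply/funext => h; rewrite log_laplace_simplex_measure /bernoulli_partition.
  by rewrite (sum_shift_basis (fun x => expR (- x))) addrCA addrC.
have KE : K + expR (- (0 + s 0 i)) = bernoulli_partition s.
  by rewrite add0r /bernoulli_partition (bigD1 i)//= addrCA addrC.
have dexp : is_derive (0:R) 1 (fun h => K + expR (- (h + s 0 i))) (- expR (- s 0 i)).
  rewrite -[- expR _]add0r; apply: is_deriveD.
  rewrite -mulrN1; apply: (@is_derive1_comp _ expR (fun h => - (h + s 0 i))).
    by rewrite add0r; exact: is_derive_expR.
  exact/is_deriveN/is_derive_translation.
rewrite -mulNr mulrC.
apply: (@is_derive1_comp _ (@ln R) (fun h => K + expR (- (h + s 0 i)))) => //.
by rewrite KE; apply: is_derive1_ln; exact: bernoulli_partition_gt0.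
Qed.

Lemma is_derive_xlnx (R : realType) (x : R) : 0 < x ->
  is_derive x 1 (fun y : R => y * ln y) (ln x + 1).
Proof.
move=> x0; have := is_deriveM (is_derive_id x 1) (is_derive1_ln x0).
by rewrite /GRing.scale /= divff ?gt_eqF// mulr1 addrC.
Qed.

(** Along $e_i$ only the $i$-th coordinate and the complement to $1$ move, in
    opposite directions, so the constants $1$ in $(x \ln x)' = \ln x + 1$
    cancel. *)
Lemma gradient_negentropy (R : realType) (n : nat) (s : 'rV[R]_n) :
  open_simplex s ->
  gradient (@negentropy R n) s = \row_i (ln (s 0 i) - ln (1 - \sum_j s 0 j)).
Proof.
move=> [s_gt0 s_lt1]; apply/rowP => i; rewrite !mxE; apply: derive_is_derive1.
pose K := \sum_(j | j != i) s 0 j * ln (s 0 j).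
pose xlnx (y : R) := y * ln y; set t := 1 - _ in s_lt1 *.
rewrite (_ : (fun h => _) =
    (fun h => xlnx (h + s 0 i) + K + xlnx (t - h))); last first.
  apply/funext => h; rewrite /negentropy (sum_shift_basis xlnx).
  rewrite (sum_shift_basis id) /= /t [in RHS](bigD1 i)//=.
  by congr (_ + xlnx _); ring.
have d1 : is_derive (0:R) 1 (fun h => xlnx (h + s 0 i)) (ln (s 0 i) + 1).
  rewrite -[_ + 1]mulr1; apply: (@is_derive1_comp _ xlnx (fun h => h + s 0 i)).
    by rewrite add0r; exact: is_derive_xlnx.
  exact: is_derive_translation.
have d2 : is_derive (0:R) 1 (fun h => xlnx (t - h)) (- (ln t + 1)).
  rewrite -mulrN1; apply: (@is_derive1_comp _ xlnx (fun h => t - h)).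
    by rewrite subr0; exact: is_derive_xlnx.
  rewrite -[X in is_derive _ _ _ X]add0r.
  exact: (is_deriveB (is_derive_cst (t : R) (0:R) (1:R)) (is_derive_id (0:R) 1)).
have := is_deriveD (is_deriveD d1 (is_derive_cst K (0:R) 1)) d2.
rewrite (_ : _ + 0 - _ = ln (s 0 i) - ln t)//.
ring.
Qed.

(** * Duality *)

Lemma gradient_log_laplace_negentropy (R : realType) (n : nat)
    (nu : {measure set 'rV[R]_n -> \bar R}) (s : 'rV[R]_n) :
  (forall s, open_simplex s -> laplace nu s = (expR (negentropy s))%:E) ->
  open_simplex s ->
  gradient (log_laplace nu) s = \row_i (ln (s 0 i) - ln (1 - \sum_j s 0 j)).
Proof.
move=> nuE ss; rewrite -gradient_negentropy//.
apply/rowP => i; rewrite !mxE; apply: near_eq_derive.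
have : nbhs s (@open_simplex R n).
  by apply: open_nbhs_nbhs; split=> //; exact: open_open_simplex.
by apply: filterS => t tt; rewrite /log_laplace nuE// expRK.
Qed.

(** The mean at $s$ has coordinates $e^{-s_i} / Z(s)$ and complement $1 / Z(s)$ to
    $1$, so it lies in the open simplex, and the $i$-th partial
    derivative of the negative entropy at this mean is
    $\ln (e^{-s_i} / Z(s)) - \ln (1 / Z(s)) = - s_i$. *)
Lemma dual_simplex_measure (R : realType) (n : nat)
    (nu : {measure set 'rV[R]_n -> \bar R}) :
  (forall s, open_simplex s -> laplace nu s = (expR (negentropy s))%:E) ->
  is_dual_measure simplex_measure nu.
Proof.
move=> nuE.
have domain : @open_simplex R n `<=` laplace_domain nu.
  rewrite -open_subsetE; last exact: open_open_simplex.
  by move=> s ss /=; rewrite nuE// ltry.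
have mean_last (s : 'rV[R]_n) :
    1 - \sum_i (\row_j (expR (- s 0 j) / bernoulli_partition s) : 'rV[R]_n) 0 i
    = (bernoulli_partition s)^-1.
  under eq_bigr do rewrite mxE.
  rewrite -mulr_suml -[X in X - _](divff (lt0r_neq0 (bernoulli_partition_gt0 s))).
  by rewrite -mulrBl addrK mul1r.
have mean_simplex s : open_simplex (- gradient (log_laplace simplex_measure) s : 'rV[R]_n).
  rewrite gradient_log_laplace_simplex_measure opprK; split=> [i|].
    by rewrite mxE divr_gt0 ?expR_gt0 ?bernoulli_partition_gt0.
  by rewrite mean_last invr_gt0 bernoulli_partition_gt0.
split.
- split; first exact: not_concentrated_negentropy.
  by exists (barycenter R n); apply: domain; exact: open_simplex_barycenter.
- by move=> _ [s _ <-]; exact: domain.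
- move=> s _; rewrite (gradient_log_laplace_negentropy nuE)//.
  rewrite gradient_log_laplace_simplex_measure opprK.
  rewrite mean_last; apply/rowP => i; rewrite !mxE.
  rewrite ln_div ?posrE ?expR_gt0 ?bernoulli_partition_gt0//.
  by rewrite lnV ?posrE ?bernoulli_partition_gt0// expRK opprK subrK opprK.
Qed.

Theorem mainTheorem7 (R : realType) (n : nat) (phi : probability R R)
    (landau_phi : is_landau phi) :
  let mu : {measure set 'rV[R]_n -> \bar R} := simplex_measure in
  let e (i : 'I_n) : 'rV[R]_n := basis_vec i in
  [/\ admissible mu,
      exponential_family mu = bernoulli_family &
      exists mustar : probability 'rV[R]_n R,
      [/\ is_dual_measure mu mustar,
          (forall s : 'rV[R]_n, (forall i, 0 < s 0 i) -> 0 < 1 - \sum_i s 0 i ->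
             laplace mustar s =
             ((\prod_i (s 0 i) `^ (s 0 i)) *
              (1 - \sum_i s 0 i) `^ (1 - \sum_i s 0 i))%:E) &
          exists psi : probability R R,
            (forall A : set R, measurable A ->
               psi A = (\int[phi]_(t in A) (expR (1 - t))%:E)%E) /\
          let nu i := image_along (e i) phi in
          let nu0 := image_along (- \sum_i e i) psi in
          [/\ forall i, concentrated_on (nu i) (line (e i)),
              concentrated_on nu0 (line (- \sum_i e i)) &
              forall A, measurable A ->
                mustar A =
                convolution (convolution_family nu) nu0 A]]].
Proof.
move=> mu e; split.
- exact: admissible_simplex_measure.
- exact: exponential_family_simplex_measure.
have [psi psiE] := tilted_landau_probability landau_phi.
pose nu i := image_along (e i) phi; pose nu0 := image_along (- \sum_i e i) psi.
pose mustar := convolution (convolution_family nu) nu0.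
have mustarE s : open_simplex s -> laplace mustar s = (expR (negentropy s))%:E.
  move=> ss; have [s_gt0 s_lt1] := ss.
  rewrite laplace_convolution laplace_convolution_family expR_negentropy//.
  have -> : laplace nu0 s = (expR (\sum_i s 0 i) *
      (1 - \sum_i s 0 i) `^ (1 - \sum_i s 0 i))%:E.
    have := laplace_tilted_landau landau_phi psiE s_lt1.
    rewrite subKr => <-; rewrite laplace_image_along.
    apply: eq_integral => t _; rewrite -mulNr; congr (expR (_ * t))%:E.
    rewrite /dot -sumrN; apply: eq_bigr => i _.
    rewrite !mxE summxE (bigD1 i)//= mxE eqxx big1 ?addr0 ?mulrN1 ?opprK// => j ji.
    by rewrite mxE (inj_eq val_inj) eq_sym (negbTE ji).
  have nuE i : laplace (nu i) s = (expR (- s 0 i) * s 0 i `^ s 0 i)%:E.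
    by rewrite laplace_image_along dot_basis landau_phi.
  rewrite (eq_bigr _ (fun i _ => nuE i)).
  (* The exponential factors of the n + 1 transforms cancel. *)
  rewrite prodEFin -EFinM big_split/= -expR_sum sumrN.
  by rewrite mulrCA mulrA mulrA -expRD addrN expR0 mul1r.
exists mustar; split.
- exact: dual_simplex_measure.
- by move=> s s_gt0 s_lt1; rewrite mustarE// expR_negentropy.
- exists psi; split=> //; split=> //.
    by move=> i; exact: concentrated_on_line.
  exact: concentrated_on_line.
Qed.
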